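(* Let $A,B,Q$ be posets and let $f:A\to Q$ and $g:B\to Q$ be order compressing maps. Suppose $f(x)=\alpha$ for some element $x$ that is maximal in $A$, and that for all $\beta\in Q$ with $\beta\neq\alpha$, $f^{-1}(\beta)=g^{-1}(\beta)$ (as subposets). If $\mathcal{G}(f^{-1}(\alpha))=\mathcal{G}(g^{-1}(\alpha))$, then $\mathcal{G}(A)=\mathcal{G}(B)$.
   Context: Poset game: played on a poset $P$ (posets are assumed such that the game is well-founded, e.g. finite); a move consists of choosing $p\in P$ and replacing $P$ by $P-p_\leq:=P\setminus\{p' : p\leq p'\}$; normal play. The nimber is defined by $\mathcal{G}(\emptyset)=0$ and $\mathcal{G}(P)=\mathrm{mex}\{\mathcal{G}(P-p_\leq):p\in P\}$, where mex is the least nonnegative integer not in the set. A function $f:P\to Q$ between posets is order compressing if for all $x,y\in P$: $f(x)=f(y)=q$ holds if and only if for every $z\in P$: (i) if $z<_P x$ and $z<_P y$ then $f(z)\leq_Q q$; (ii) if $z\not<_P x$ and $z\not<_P y$ then $f(z)\not<_Q q$; (iii) if exactly one of $z<_P x$, $z<_P y$ holds, then $f(z)=q$. For $q\in Q$, $f^{-1}(q)$ denotes the subposet of $P$ (induced order) on the preimage of $q$. *)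

(* Defs.v *)
From mathcomp Require Import all_boot all_order.
From mathcomp Require Import boolp classical_sets functions cardinality.
Set Implicit Arguments.
Unset Strict Implicit.
Unset Printing Implicit Defensive.
Import Order.TTheory.
Local Open Scope classical_set_scope.

(* A poset is a subset of an ambient type with an order on it, rather than a
   type of its own, so that subposets of two different posets can be equal.
   The values of [pole] outside the carrier are irrelevant. *)
Record poset (T : Type) := Poset {
  carrier :> T -> Prop;
  pole : T -> T -> Prop;
  pole_refl : forall x, carrier x -> pole x x;
  pole_anti : forall x y, carrier x -> carrier y ->
    pole x y -> pole y x -> x = y;
  pole_trans : forall x y z, carrier x -> carrier y -> carrier z ->
    pole x y -> pole y z -> pole x z }.

Definition polt (T : Type) (P : poset T) (x y : T) : Prop :=
  pole P x y /\ x <> y.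

Definition subposet (T : Type) (P : poset T) (S : set T) : poset T :=
  @Poset T (carrier P `&` S) (pole P)
    (fun x Px => pole_refl Px.1)
    (fun x y Px Py => pole_anti Px.1 Py.1)
    (fun x y z Px Py Pz => pole_trans Px.1 Py.1 Pz.1).

Definition eq_poset (T : Type) (P P' : poset T) : Prop :=
  carrier P = carrier P' /\ (forall x y, P x -> P y -> (pole P x y <-> pole P' x y)).

Definition maximal (T : Type) (P : poset T) (x : T) : Prop :=
  P x /\ (forall y, P y -> pole P x y -> y = x).

Definition remove (T : Type) (P : poset T) (p : T) : poset T :=
  subposet P [set x | ~ pole P p x].

Definition is_mex (S : set nat) (n : nat) : Prop :=
  ~ S n /\ (forall k, k < n -> S k).

(* Being inductive, [has_nimber P n] also says that the game on [P] is
   well-founded. *)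
Inductive has_nimber (T : Type) : poset T -> nat -> Prop :=
| HasNimber (P : poset T) (G : T -> nat) (n : nat) :
    (forall p, P p -> has_nimber (remove P p) (G p)) ->
    is_mex [set G p | p in carrier P] n ->
    has_nimber P n.

(* Every finite poset is playable ([finite_playable]). An infinite one is when
   its game is well-founded and every mex met is a natural number, unlike for
   the chain of natural numbers, where the options take all values. *)
Definition playable (T : Type) (P : poset T) : Prop :=
  exists n, has_nimber P n.

(* Meaningful only when [P] is playable. *)
Definition nimber (T : Type) (P : poset T) : nat := xget 0 (has_nimber P).

Section OrderCompressing.
Variables (T : Type) (d : Order.disp_t) (Q : porderType d).
Implicit Types (P : poset T) (f : T -> Q).

(* A map from [P] to [Q] is given by a function on the ambient type, whose
   values outside [P] are irrelevant. *)
Definition fiber P f (q : Q) : poset T := subposet P [set x | f x = q].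

Definition compress_cond P f (x y : T) (q : Q) : Prop :=
  forall z, P z ->
    [/\ polt P z x -> polt P z y -> (f z <= q)%O,
        ~ polt P z x -> ~ polt P z y -> ~~ (f z < q)%O
      & (polt P z x /\ ~ polt P z y) \/ (~ polt P z x /\ polt P z y) ->
        f z = q].

(* The definition is often worded as an equivalence between [f x = f y = q]
   and the three conditions. Only the direct implication can be meant: adding
   the converse, even just for [q = f x], would leave only constant maps on
   playable posets ([order_compressing_converse_const]), ruling out the
   identity of a two-element poset. *)
Definition order_compressing P f : Prop :=
  forall x y q, P x -> P y -> f x = q -> f y = q -> compress_cond P f x y q.

End OrderCompressing.

Lemma has_nimber_unique (T : Type) (P : poset T) (m n : nat) :
  has_nimber P m -> has_nimber P n -> m = n.
Proof.
move=> Pm; elim: Pm n => {m}P G m _ IH [mG mI] n Pn.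
case: Pn IH mG mI => {n}P G' n PG' [nG nI] IH mG mI.
have e p : P p -> G p = G' p by move=> Pp; exact: IH (PG' p Pp).
case: (ltngtP m n) => // [/nI|/mI] [p Pp Ep].
- by case: mG; exists p => //; rewrite e.
- by case: nG; exists p => //; rewrite -e.
Qed.

Lemma has_nimber_nimber (T : Type) (P : poset T) (n : nat) :
  has_nimber P n -> nimber P = n.
Proof.
by move=> Pn; rewrite /nimber; case: xgetP => [m _ Pm|/(_ n)//];
  exact: has_nimber_unique Pm Pn.
Qed.

Lemma playable_remove (T : Type) (P : poset T) (p : T) :
  playable P -> P p -> playable (remove P p).
Proof. by case=> n; case=> {n}R G n RG _ Rp; exists (G p); exact: RG. Qed.

Lemma nimber_is_mex (T : Type) (P : poset T) :
  playable P -> is_mex [set nimber (remove P p) | p in carrier P] (nimber P).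
Proof.
case=> n Pn; rewrite (has_nimber_nimber Pn).
case: Pn => {n}R G n RG mex.
suff -> : [set nimber (remove R p) | p in carrier R] = [set G p | p in carrier R] by [].
by apply/seteqP; split=> _ [p Rp <-]; exists p => //;
  rewrite (has_nimber_nimber (RG p Rp)).
Qed.

Lemma finite_playable (T : Type) (P : poset T) : finite_set (carrier P) -> playable P.
Proof.
move=> /(@finite_seqP {classic T} (carrier P))[s Ps].
have {}Ps : forall x : {classic T}, P x -> x \in s by move=> x; rewrite Ps.
have [n] := ubnP (size s); elim: n s P Ps => // n IH s P Ps sn.
have opt p : P p -> playable (remove P p).
  move=> Pp; apply: (IH [seq x <- s | x != p :> {classic T}]) => [x [Px npx]|].
    rewrite mem_filter Ps// andbT; apply/eqP => xp.
    by apply: npx; rewrite xp; exact: pole_refl.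
  rewrite (leq_trans _ (_ : size s <= n))// size_filter.
  by rewrite -(count_predC (pred1 (p : {classic T}))) -[ltnLHS]add0n ltn_add2r
    -has_count has_pred1 Ps.
pose G p := nimber (remove P p).
have PG p : P p -> has_nimber (remove P p) (G p).
  by move=> /opt[k Pk]; rewrite /G (has_nimber_nimber Pk).
have [k Gk] : exists k, `[< ~ [set G p | p in carrier P] k >].
  exists (\max_(x <- s) G x).+1; apply/asboolP => -[p Pp Gp].
  suff : G p <= \max_(x <- s) G x by rewrite Gp ltnn.
  by apply: (@leq_bigmax_seq {classic T} s xpredT G) => //; exact: Ps.
have exk : exists k, `[< ~ [set G p | p in carrier P] k >] by exists k.
case: (ex_minnP exk) => m /asboolP mG mmin.
exists m; apply: (HasNimber PG); split => // j jm.
by apply: contrapT => jG; have := mmin j (asboolT jG); rewrite leqNgt jm.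
Qed.

Lemma playable_min (T : Type) (P : poset T) (S : set T) :
  playable P -> S `<=` carrier P -> S !=set0 ->
  exists2 m, S m & forall s, S s -> ~ polt P s m.
Proof.
case=> n Pn; elim: Pn S => {n}P G n _ IH _ S SP [p Sp].
have [[s [Ss ps]]|noS] := pselect (exists s, S s /\ ~ pole P p s); last first.
  exists p => // s Ss [sp nsp]; apply: nsp.
  apply: (pole_anti (SP _ Ss) (SP _ Sp)) => //.
  by apply: contrapT => nps; apply: noS; exists s.
have [|m [Sm pm] mmin] := IH p (SP _ Sp) (S `&` [set x | ~ pole P p x]) _
  (ex_intro _ s (conj Ss ps)).
  by move=> x [/SP Px npx].
exists m => // t St [tm ntm]; apply: (mmin t) => //; split=> // pt; apply: pm.
by apply: (pole_trans (SP _ Sp) (SP _ St) (SP _ Sm)).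
Qed.

Lemma order_compressing_converse_const (T : Type) (d : Order.disp_t)
    (Q : porderType d) (P : poset T) (f : T -> Q) :
  playable P -> order_compressing P f ->
  (forall x y, P x -> P y -> compress_cond P f x y (f x) -> f x = f y) ->
  forall x y, P x -> P y -> f x = f y.
Proof.
move=> playP cf conv x y Px Py.
have [x0 Px0 x0min] := playable_min playP (@subset_refl _ _) (ex_intro _ x Px).
suff cst z : P z -> f z = f x0 by rewrite !cst.
move=> {x y Px Py}; apply: contraPP => fz Pz.
have [||y [Py fy] ymin] := @playable_min _ _ (carrier P `&` [set y | f y <> f x0]) playP.
- by move=> ? [].
- by exists z.
have below t : P t -> polt P t y -> f t = f x0.
  by move=> Pt ty; apply: contrapT => ft; exact: (ymin t).
apply: fy.
have [[t [Pt ty]]|not] := pselect (exists t, P t /\ polt P t y); last first.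
  symmetry; apply: (conv x0 y) => // t Pt.
  have [c1 c2 c3] := cf x0 x0 _ Px0 Px0 erefl erefl t Pt.
  have nty : ~ polt P t y by move=> ty; apply: not; exists t.
  by split=> // [_ _|[[/(x0min _ Pt)]|[]]//]; apply: c2; exact: x0min.
rewrite -(below t Pt ty); symmetry; apply: (conv t y) => // u Pu.
have [c1 c2 c3] := cf t t _ Pt Pt erefl erefl u Pu.
split=> [ut _|nut _|]; [exact: c1|exact: c2|].
case=> -[]; last by move=> _ /(below u Pu)->; rewrite below.
move=> [ut nut] []; split; first exact: pole_trans ut ty.1.
move=> uy; apply: nut; apply: (pole_anti Pu Pt) => //.
by rewrite uy; exact: ty.1.
Qed.

(* Main.v *)
(** The order between distinct fibers of an order compressing map is that of
    their images, so a poset is the lexicographic sum of its fibers.  As no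
    fiber lies above the one over [alpha], playing in that fiber leaves the
    other ones untouched.  If [B] had an option of nimber [nimber A], then
    either [A] would have the matching option, or the move would have increased
    the nimber of the fiber over [alpha] and could be reversed; by induction,
    some game would have an option of its own nimber. *)
Require Import Defs.
From mathcomp Require Import all_boot all_order.
From mathcomp Require Import boolp classical_sets.

Set Implicit Arguments.
Unset Strict Implicit.
Unset Printing Implicit Defensive.
Import Order.TTheory.
Local Open Scope classical_set_scope.

(** * Games on equal posets, and induction on games *)

Section Posets.
Variable T : Type.
Implicit Types P : poset T.

Lemma eq_poset_sym P P' : eq_poset P P' -> eq_poset P' P.
Proof. by move=> [e le]; split=> // x y; rewrite -e => Px Py; rewrite le. Qed.

Lemma eq_poset_trans P P' P'' :
  eq_poset P P' -> eq_poset P' P'' -> eq_poset P P''.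
Proof.
move=> [e1 le1] [e2 le2]; split; first by rewrite e1.
by move=> x y Px Py; rewrite le1// le2// -e1.
Qed.

Lemma eq_poset_remove P P' p :
  eq_poset P P' -> P p -> eq_poset (remove P p) (remove P' p).
Proof.
move=> [e le] Pp; split; last by move=> x y [Px _] [Py _]; exact: le.
apply/seteqP; split=> x /= [Px npx]; split.
- by rewrite -e.
- by rewrite /= -le.
- by rewrite e.
- by rewrite /= le// e.
Qed.

Lemma eq_poset_has_nimber P P' n :
  eq_poset P P' -> has_nimber P n -> has_nimber P' n.
Proof.
move=> eP Pn; elim: Pn P' eP => {n}P G n _ IH mexn P' eP.
apply: (@HasNimber _ _ G); last by rewrite -eP.1.
move=> p; rewrite -eP.1 => Pp; apply: IH => //; exact: eq_poset_remove.
Qed.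

Lemma eq_poset_playable P P' : eq_poset P P' -> playable P -> playable P'.
Proof. by move=> eP [n Pn]; exists n; exact: eq_poset_has_nimber Pn. Qed.

Lemma eq_poset_nimber P P' : eq_poset P P' -> nimber P = nimber P'.
Proof.
move=> eP; rewrite /nimber; congr xget; apply/funext => n; apply/propext.
split; apply: eq_poset_has_nimber => //; exact: eq_poset_sym.
Qed.

Lemma eq_poset0 P P' :
  (forall x, ~ P x) -> (forall x, ~ P' x) -> eq_poset P P'.
Proof.
by move=> P0 P'0; split=> [|x y /P0//]; apply/seteqP; split=> x /= => [/P0|/P'0].
Qed.

Lemma nimber_option_neq P p :
  playable P -> P p -> nimber (remove P p) <> nimber P.
Proof. by move=> /nimber_is_mex[nP _] Pp e; apply: nP; exists p. Qed.

Lemma nimber_option_lt P k : playable P -> k < nimber P ->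
  exists2 p, P p & nimber (remove P p) = k.
Proof. by move=> /nimber_is_mex[_ ltP] /ltP[p Pp <-]; exists p. Qed.

(** The hypothesis after two moves is what allows a move to be answered by a reply that reverses
    it. *)
Lemma playable_ind2 (K : poset T -> Prop) :
  (forall P, playable P -> (forall p, P p -> K (remove P p)) ->
    (forall p q, P p -> remove P p q -> K (remove (remove P p) q)) -> K P) ->
  forall P, playable P -> K P.
Proof.
move=> step P [n Pn].
(* Carrying the claim for all options too makes a one-move induction reach two moves deep. *)
suff [] : K P /\ forall p, P p -> K (remove P p) by [].
elim: Pn => {n}P G n PG IH mexn; split=> [|p /IH[]//].
apply: step => [|p /IH[]//|p q /IH[_ Kq] /Kq//].
by exists n; exact: HasNimber mexn.
Qed.

End Posets.

(** * Order between fibers, and the effect of a move on a fiber *)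

Section LexicographicSum.
Variables (T : Type) (d : Order.disp_t) (Q : porderType d) (alpha : Q).
Implicit Types (P A B : poset T) (f g : T -> Q).

(** Compare [y] with itself, taking [x] as third point: clause (i) gives one direction and clause
    (ii) the other. *)
Lemma order_compressing_lt P f x y : order_compressing P f -> P x -> P y ->
  f x <> f y -> (polt P x y <-> (f x < f y)%O).
Proof.
move=> cf Px Py fxy; have [le nlt _] := cf y y _ Py Py erefl erefl x Px.
split=> [xy|fltxy]; first by rewrite lt_neqAle le// andbT; exact/eqP.
by apply: contrapT => xy; move: (nlt xy xy); rewrite fltxy.
Qed.

Lemma order_compressing_le P f x y : order_compressing P f -> P x -> P y ->
  f x <> f y -> (pole P x y <-> (f x < f y)%O).
Proof.
move=> cf Px Py fxy; rewrite -(order_compressing_lt cf)//.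
by split=> [xy|[]//]; split=> // exy; apply: fxy; rewrite exy.
Qed.

Lemma order_compressing_remove P f p :
  order_compressing P f -> order_compressing (remove P p) f.
Proof. by move=> cf x y q [Px _] [Py _] fx fy z [Pz _]; exact: cf. Qed.

Lemma fiber_remove P f p q :
  eq_poset (fiber (remove P p) f q) (remove (fiber P f q) p).
Proof. by split=> //; exact: setIAC. Qed.

Lemma fiber_remove_other P f p q : order_compressing P f -> P p ->
  f p <> q -> ~ (f p < q)%O -> eq_poset (fiber (remove P p) f q) (fiber P f q).
Proof.
move=> cf Pp fpq nlt; split=> //; apply/seteqP; split=> [x [[]]//|x [Px fx]].
split=> //; split=> // px; apply: nlt; rewrite -fx.
by apply/(order_compressing_le cf) => //; rewrite fx.
Qed.

Lemma fiber_remove_lt P f p q : order_compressing P f -> P p ->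
  (f p < q)%O -> forall x, ~ fiber (remove P p) f q x.
Proof.
move=> cf Pp lt x [[Px npx] fx]; apply: npx.
by apply/(order_compressing_le cf) => //; rewrite fx//; move: lt => /lt_eqF/eqP.
Qed.

(** Having a maximal point over [alpha] can be lost when a move empties that fiber; having no value
    above [alpha] survives every move. *)
Record top_fiber P f : Prop := TopFiber {
  top_fiber_playable : playable P;
  top_fiber_fiber : playable (fiber P f alpha);
  top_fiber_compressing : order_compressing P f;
  top_fiber_top : forall z, P z -> ~ (alpha < f z)%O }.

(** For the fiber over [alpha]: a move inside it is a move of its own game, a move below it empties
    it, and any other move preserves it. *)
Lemma top_fiber_remove P f p : top_fiber P f -> P p -> top_fiber (remove P p) f.
Proof.
move=> [play playf cf top] Pp; split=> [||x y q|z [/top]//].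
- exact: playable_remove.
- have [fp|fp] := pselect (f p = alpha).
    apply: eq_poset_playable (eq_poset_sym (fiber_remove _ _ _ _)) _.
    exact: playable_remove.
  have [lt|nlt] := boolP (f p < alpha)%O.
    apply: finite_playable; rewrite (_ : carrier _ = set0)//.
    apply/seteqP; split=> // x; exact: (fiber_remove_lt cf Pp lt).
  apply: eq_poset_playable playf; apply: eq_poset_sym.
  by apply: fiber_remove_other => //; exact/negP.
- exact: order_compressing_remove.
Qed.

(** * Posets that agree outside the fiber over [alpha] *)

Definition eq_off A f B g := forall q, q <> alpha ->
  eq_poset (fiber A f q) (fiber B g q).

Lemma eq_off_sym A f B g : eq_off A f B g -> eq_off B g A f.
Proof. by move=> AB q /AB/eq_poset_sym. Qed.

Lemma eq_off_trans A f B g C h :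
  eq_off A f B g -> eq_off B g C h -> eq_off A f C h.
Proof. by move=> AB BC q qa; apply: eq_poset_trans (AB q qa) (BC q qa). Qed.

Lemma eq_off_mem A f B g x : eq_off A f B g ->
  A x -> f x <> alpha -> B x /\ g x = f x.
Proof. by move=> AB Ax /AB[e _]; have : fiber A f (f x) x; rewrite // e. Qed.

(** Inside a fiber the order is shared; across fibers it is read off from the images, which
    agree. *)
Lemma eq_off_le A f B g x y : eq_off A f B g ->
  order_compressing A f -> order_compressing B g ->
  A x -> f x <> alpha -> A y -> f y <> alpha -> (pole A x y <-> pole B x y).
Proof.
move=> AB cf cg Ax fx Ay fy.
have [[Bx gx] [By gy]] := (eq_off_mem AB Ax fx, eq_off_mem AB Ay fy).
have [fxy|fxy] := pselect (f x = f y); first exact: (AB _ fy).2.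
by rewrite (order_compressing_le cf)// (order_compressing_le cg) ?gx ?gy.
Qed.

Lemma eq_off_remove A f B g p : eq_off A f B g ->
  order_compressing A f -> order_compressing B g -> A p -> f p <> alpha ->
  eq_off (remove A p) f (remove B p) g.
Proof.
move=> AB cf cg Ap fp q qa; have [Bp gp] := eq_off_mem AB Ap fp; split.
  apply/seteqP; split=> x [[Px npx] fx].
  - have fxa : f x <> alpha by rewrite fx.
    have [Bx gx] := eq_off_mem AB Px fxa.
    split; last by rewrite -fx -gx.
    by split=> // px; apply: npx; apply/(eq_off_le AB).
  - have gxa : g x <> alpha by rewrite fx.
    have [Ax gx] := eq_off_mem (eq_off_sym AB) Px gxa.
    split; last by rewrite -fx -gx.
    by split=> // px; apply: npx; apply/(eq_off_le AB); rewrite // gx.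
move=> x y [[Ax _] fx] [[Ay _] fy].
by apply: (eq_off_le AB) => //; rewrite ?fx ?fy.
Qed.

Lemma eq_off_remove_top P f p : top_fiber P f -> P p -> f p = alpha ->
  eq_off (remove P p) f P f.
Proof.
move=> [_ _ cf top] Pp fp q qa.
(* Only attained values are known not to exceed [alpha]; over any other [q] both fibers are
   empty. *)
have [[x [Px fx]]|nox] := pselect (exists x, P x /\ f x = q).
  apply: fiber_remove_other => //; rewrite fp; first exact/nesym.
  by rewrite -fx; exact: top.
by apply: eq_poset0 => x [Px fx]; apply: nox; exists x => //; case: Px.
Qed.

(** The invariant of the induction, symmetric in the two posets so that their roles can be
    exchanged. *)
Record matched A f B g : Prop := Matched {
  matched_topl : top_fiber A f;
  matched_topr : top_fiber B g;
  matched_off : eq_off A f B g;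
  matched_nimber : nimber (fiber A f alpha) = nimber (fiber B g alpha) }.

Lemma matched_sym A f B g : matched A f B g -> matched B g A f.
Proof. by move=> [tA tB AB e]; split=> //; exact: eq_off_sym. Qed.

Lemma matched_remove A f B g p : matched A f B g -> A p -> f p <> alpha ->
  matched (remove A p) f (remove B p) g.
Proof.
move=> [tA tB AB e] Ap fp; have [Bp gp] := eq_off_mem AB Ap fp.
have [cf cg] := (top_fiber_compressing tA, top_fiber_compressing tB).
split; [exact: top_fiber_remove..|exact: eq_off_remove|].
have [lt|/negP nlt] := boolP (f p < alpha)%O.
  apply/eq_poset_nimber/eq_poset0; first exact: fiber_remove_lt.
  by apply: fiber_remove_lt; rewrite ?gp.
rewrite (eq_poset_nimber (fiber_remove_other cf _ _ _))// e.
by rewrite (eq_poset_nimber (fiber_remove_other cg _ _ _))// gp.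
Qed.

Lemma nimber_fiber_remove P f p :
  nimber (fiber (remove P p) f alpha) = nimber (remove (fiber P f alpha) p).
Proof. exact/eq_poset_nimber/fiber_remove. Qed.

(** The first two premises are the induction hypotheses, for one move in each poset and for two
    moves in [B]; stating them here lets the argument serve both directions. *)
Lemma matched_option_neq A f B g :
  (forall p q, A p -> B q -> matched (remove A p) f (remove B q) g ->
    nimber (remove A p) = nimber (remove B q)) ->
  (forall p q, B p -> remove B p q ->
    matched A f (remove (remove B p) q) g ->
    nimber A = nimber (remove (remove B p) q)) ->
  matched A f B g -> forall p, B p -> nimber (remove B p) <> nimber A.
Proof.
move=> IH1 IH2 AB p Bp; have [tA tB off e] := AB.
have [gp|gp] := pselect (g p = alpha); last first.
  (* Outside the fiber over [alpha], the same move is available in [A]. *)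
  have [Ap fp] := eq_off_mem (eq_off_sym off) Bp gp.
  rewrite -(IH1 p p)//; first exact: nimber_option_neq (top_fiber_playable tA) Ap.
  by apply: matched_remove => //; rewrite fp.
have tBp := top_fiber_remove tB Bp.
have offp := eq_off_remove_top tB Bp gp.
case: (ltngtP (nimber (fiber (remove B p) g alpha)) (nimber (fiber B g alpha))).
(* The nimber of the fiber drops: some move [q] in the fiber of [A] reaches the same value. *)
- rewrite -e => /(nimber_option_lt (top_fiber_fiber tA))[q [Aq fq] eq].
  rewrite -(IH1 q p)//; first exact: nimber_option_neq (top_fiber_playable tA) Aq.
  split=> //; [exact: top_fiber_remove| |by rewrite nimber_fiber_remove].
  apply: eq_off_trans (eq_off_remove_top tA Aq fq) _.
  exact: eq_off_trans off (eq_off_sym offp).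
(* The nimber of the fiber rises: a reply [q] restores it, so [A] has the nimber of an option of
   [remove B p]. *)
- move=> /(nimber_option_lt (top_fiber_fiber tBp))[q [Bq gq] eq].
  rewrite (IH2 p q)//.
    exact/nesym/(nimber_option_neq (top_fiber_playable tBp) Bq).
  split=> //; [exact: top_fiber_remove| |by rewrite nimber_fiber_remove eq].
  apply: eq_off_trans off (eq_off_sym _).
  exact: eq_off_trans (eq_off_remove_top tBp Bq gq) offp.
- rewrite nimber_fiber_remove => eq.
  by case: (nimber_option_neq (top_fiber_fiber tB) _ eq).
Qed.

Lemma matched_nimber_eq A f B g : matched A f B g -> nimber A = nimber B.
Proof.
move=> AB; have playA := top_fiber_playable (matched_topl AB).
(* The outer induction on [A] quantifies over all [B]; the inner one, on [B], handles two moves in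
   [B] with [A] unchanged. *)
move: A playA B AB; apply: playable_ind2 => A playA IHA1 IHA2 B AB.
have playB := top_fiber_playable (matched_topr AB).
move: B playB AB; apply: playable_ind2 => B playB _ IHB2 AB.
have neqB : forall p, B p -> nimber (remove B p) <> nimber A.
  apply: (@matched_option_neq A f B g _ _ AB) => [p q Ap _|].
    exact: IHA1.
  exact: IHB2.
have neqA : forall p, A p -> nimber (remove A p) <> nimber B.
  apply: (@matched_option_neq B g A f _ _ (matched_sym AB)) => [p q Bp Aq|p q Ap Aq] /matched_sym.
    by move=> /IHA1->.
  by move=> /IHA2->.
(* The smaller nimber would be that of an option of the other poset. *)
case: (ltngtP (nimber A) (nimber B)) => //.
- by move=> /(nimber_option_lt playB)[p /neqB].
- by move=> /(nimber_option_lt playA)[p /neqA].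
Qed.

End LexicographicSum.

Theorem theorem2 (T : Type) (d : Order.disp_t) (Q : porderType d)
    (A B : poset T) (f g : T -> Q) (alpha : Q)
    (playA : playable A) (playB : playable B)
    (play_fiberA : playable (fiber A f alpha))
    (play_fiberB : playable (fiber B g alpha))
    (cf : order_compressing A f) (cg : order_compressing B g)
    (maxA : exists x, maximal A x /\ f x = alpha)
    (eq_fibers : forall beta : Q, beta <> alpha ->
       eq_poset (fiber A f beta) (fiber B g beta))
    (eq_nimber : nimber (fiber A f alpha) = nimber (fiber B g alpha)) :
  nimber A = nimber B.
Proof.
have [x [[Ax xmax] fx]] := maxA.
(* A point with image above [alpha] would lie strictly above the maximal point [x]. *)
have topA z : A z -> ~ (alpha < f z)%O.
  move=> Az; rewrite -fx => xz.
  have zx : f x <> f z by apply/eqP; rewrite lt_eqF.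
  by apply/zx; rewrite (xmax z)//; apply/(order_compressing_le cf Ax Az zx).
apply: (@matched_nimber_eq _ _ _ alpha _ f _ g); split=> //; split=> // z Bz az.
(* A point of [B] with image above [alpha] lies in a shared fiber, hence in [A] with the same
   image. *)
have ga : g z <> alpha by apply/eqP; rewrite gt_eqF.
have [Az fz] := eq_off_mem (eq_off_sym eq_fibers) Bz ga.
by apply: (topA z Az); rewrite fz.
Qed.
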